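(* Let $k\ge 5$ be an odd integer. (1) For every positive integer $t$, $$\mathrm{ex}_{C_k(t)}(n,C_{k-2})=\frac{n^2}{(kt)^2}+o(n^2)\qquad (n\to\infty).$$ (2) For every positive integer $t$ and every $\epsilon>0$ there exists an integer $N=N(k,t,\epsilon)$ such that for each $n>N$ the following holds: if $H$ is an $n$-vertex graph consisting of $\mathrm{ex}_{C_k(t)}(n,C_{k-2})-\epsilon n^2$ monochromatic $C_k(t)$-copies and containing no rainbow $C_{k-2}$, then one can delete at most $2\epsilon(ktn)^2$ monochromatic $C_k(t)$-copies from $H$ such that the resulting graph is a subgraph of a blow-up of $C_k$.
   Context: All graphs are finite and simple. $C_m$ denotes the cycle of length $m$. A blow-up of a graph $G$ is obtained by replacing each vertex $v$ of $G$ by a vertex set $X_v$ (the sets being disjoint and independent) and joining every vertex of $X_u$ to every vertex of $X_v$ exactly when $uv\in E(G)$; the $t$-blow-up $G(t)$ is the blow-up with $|X_v|=t$ for all $v$. For graphs $F$ and $G$, the $F$-multicolor Turán number $\mathrm{ex}_F(n,G)$ is the maximum number of pairwise edge-disjoint copies of $F$ on a common vertex set of $n$ vertices such that the union of these copies contains no copy of $G$ whose edges all come from pairwise distinct copies of $F$ in the family. A graph $H$ ''consisting of $m$ monochromatic $F$-copies'' is a graph whose edge set is partitioned into the edge sets of $m$ designated copies of $F$, each designated copy being assigned its own distinct color on its edges; the designated copies are the monochromatic $F$-copies. A subgraph is rainbow if its edges have pairwise distinct colors. Deleting a monochromatic $F$-copy means deleting its edges. *)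

(* Defs.v *)
From mathcomp Require Import all_boot.

Set Implicit Arguments.
Unset Strict Implicit.
Unset Printing Implicit Defensive.

Record sgraph := SGraph {
  vertex :> finType;
  adj : rel vertex;
  adj_sym : symmetric adj;
  adj_irr : irreflexive adj
}.

Definition edges (G : sgraph) : {set {set G}} :=
  [set [set p.1; p.2] | p : G * G & adj p.1 p.2].

Section EdgeGraph.
Variables (V : finType) (E : {set {set V}}).

Definition edge_rel : rel V := [rel x y | (x != y) && ([set x; y] \in E)].

Lemma edge_rel_sym : symmetric edge_rel.
Proof. by move=> x y; rewrite /edge_rel /= eq_sym setUC. Qed.

Lemma edge_rel_irr : irreflexive edge_rel.
Proof. by move=> x; rewrite /edge_rel /= eqxx. Qed.

Definition edge_graph : sgraph := SGraph edge_rel_sym edge_rel_irr.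
End EdgeGraph.

(* The conjunct i != j only matters for m = 1; for m >= 3 this is C_m, while
   for m = 2 it is a single edge. *)
Section Cycle.
Variable m : nat.

Definition cycle_rel : rel 'I_m :=
  [rel i j | (i != j) && ((j == ordS i) || (i == ordS j))].

Lemma cycle_rel_sym : symmetric cycle_rel.
Proof. by move=> i j; rewrite /cycle_rel /= eq_sym orbC. Qed.

Lemma cycle_rel_irr : irreflexive cycle_rel.
Proof. by move=> i; rewrite /cycle_rel /= eqxx. Qed.

Definition cycle_graph : sgraph := SGraph cycle_rel_sym cycle_rel_irr.
End Cycle.

Section Blowup.
Variables (G : sgraph) (X : G -> finType).

Definition blowup_rel : rel {v : G & X v} := [rel x y | adj (tag x) (tag y)].

Lemma blowup_rel_sym : symmetric blowup_rel.
Proof. by move=> x y; rewrite /blowup_rel /= adj_sym. Qed.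

Lemma blowup_rel_irr : irreflexive blowup_rel.
Proof. by move=> x; rewrite /blowup_rel /= adj_irr. Qed.

Definition blowup : sgraph := SGraph blowup_rel_sym blowup_rel_irr.
End Blowup.

Definition tblowup (G : sgraph) (t : nat) : sgraph :=
  blowup (fun _ : G => 'I_t : finType).

Definition is_subgraph (G K : sgraph) : Prop :=
  exists f : G -> K, injective f /\ forall x y, adj x y -> adj (f x) (f y).

(* A copy is identified with its edge set, which determines it as long as F
   has no isolated vertices. *)
Definition is_copy (F : sgraph) (V : finType) (B : {set {set V}}) : bool :=
  [exists f : {ffun F -> V},
    injectiveb f && (B == [set f @: e | e : {set F} in edges F])].

(* A is a family of pairwise disjoint edge sets, each standing for one colour;
   the colour of an edge e of their union is the block pblock A e. *)
Definition rainbow (G : sgraph) (V : finType) (A : {set {set {set V}}}) : bool :=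
  [exists B : {set {set V}},
    [&& is_copy G B, B \subset cover A & dinjectiveb (pblock A) B]].

Definition multicolor_family (F G : sgraph) (V : finType)
    (A : {set {set {set V}}}) : bool :=
  [&& trivIset A, [forall B in A, is_copy F B] & ~~ rainbow G A].

Definition ex_multicolor (F : sgraph) (n : nat) (G : sgraph) : nat :=
  \max_(A : {set {set {set 'I_n}}} | multicolor_family F G A) #|A|.

Definition mono_copies (F H : sgraph) (A : {set {set {set H}}}) : bool :=
  partition A (edges H) && [forall B in A, is_copy F B].

Definition delete_copies (H : sgraph) (D : {set {set {set H}}}) : sgraph :=
  edge_graph (edges H :\: cover D).

(* Main.v *)
(** Whenever [u] is adjacent to three classes of a monochromatic copy, or two
    adjacent vertices sit in non-consecutive classes relative to a copy, there
    is a closed walk of odd length at most k - 2 one of whose segments lies in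
    the copy. Such a walk is not rainbow, but it is usually part of many: let
    [level 0 u] be the neighbourhood of [u] and [level i.+1 u] the vertices
    with at least d neighbours in [level i u]. Few edges leave the level
    structure, and an edge inside [level s u], with k = 2s + 5, closes at
    least d^(2s) walks of length k - 2. Since colour classes have bounded size, all but
    O(n^(k-3)) closed walks of length k - 2 are rainbow cycles, so for d
    a small multiple of n the critical triples are o(n^3) in number. This
    replaces the removal lemma.

    A vertex in no critical configuration with a copy sends at most 2t edges
    to it. Double counting and Cauchy-Schwarz give the upper bound. For the
    stability, a copy which is average for the total defect assigns
    consecutive classes to the ends of all edges outside few copies.

    For the lower bound, the copies in the blow-up are indexed by (x, y) in
    (Z/q)^2, the offsets in the successive classes being
    x, y, x, y, ..., x, y, x + y; any two consecutive offsets determine (x, y). *)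
Require Import Defs.
From HB Require Import structures.
From mathcomp Require Import all_boot all_order all_algebra zify lra ring.
Set Implicit Arguments.
Unset Strict Implicit.
Unset Printing Implicit Defensive.

(** * Walks in the cycle *)

Lemma ordS_neq k (i : 'I_k) : 1 < k -> ordS i != i.
Proof.
move=> k1; rewrite -val_eqE /=; have := ltn_ord i; rewrite leq_eqVlt => /predU1P[ik|ik].
  by rewrite ik modnn; lia.
by rewrite modn_small; lia.
Qed.

Lemma cycle_relE k (i j : 'I_k) : 2 < k ->
  cycle_rel i j = [|| j == i.+1 :> nat, i == j.+1 :> nat,
                      (i == 0 :> nat) && (j.+1 == k) | (j == 0 :> nat) && (i.+1 == k)].
Proof.
have ordSE (x y : 'I_k) :
    (y == ordS x) = ((y == x.+1 :> nat) || ((y == 0 :> nat) && (x.+1 == k))).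
  rewrite -val_eqE /=; have [xk|] := ltnP x.+1 k.
    rewrite modn_small //; lia.
  have := ltn_ord x; have := ltn_ord y => yk xk kx.
  have -> : x.+1 = k by lia.
  rewrite modnn; lia.
move=> k2; rewrite /cycle_rel /= !ordSE -val_eqE /=.
have := ltn_ord i; have := ltn_ord j; lia.
Qed.

(* Existence of a walk of length [m] from [i] to [j] in C_k: [l] of its steps
   go down, and for [m < k] it wraps around at most once. *)
Definition cycle_walk k m i j := exists2 l, l <= m &
  [\/ i + m = j + l.*2, i + m = j + l.*2 + k | i + m + k = j + l.*2].

Lemma cycle_walk_sym k m i j : cycle_walk k m i j -> cycle_walk k m j i.
Proof.
case=> l lm H; exists (m - l); first lia.
by case: H => H; [apply: Or31|apply: Or33|apply: Or32]; lia.
Qed.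

(** The first step goes up unless all steps go down. The bound [m < k] excludes a second
    wrap-around, so the three equations still suffice. *)
Lemma cycle_walkS k m (i j : 'I_k) : 2 < k -> m < k ->
  cycle_walk k m.+1 i j -> exists2 c : 'I_k, cycle_rel i c & cycle_walk k m c j.
Proof.
move=> k2 mk [l lm H]; have ik := ltn_ord i; have jk := ltn_ord j.
have [lm'|lm'] := leqP l m.
  have [ik'|ik'] := ltnP i.+1 k.
    exists (Ordinal ik'); first by rewrite cycle_relE //= eqxx.
    by exists l => //; case: H => H; [apply: Or31|apply: Or32|apply: Or33] => /=; lia.
  have k0 : 0 < k by lia.
  exists (Ordinal k0); first by rewrite cycle_relE //=; lia.
  exists l => //; case: H => H /=; [apply: Or33|apply: Or31|apply: Or33]; lia.
have [i0|i0] := posnP i.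
  have k1 : k.-1 < k by lia.
  exists (Ordinal k1); first by rewrite cycle_relE //=; lia.
  exists l.-1; first lia.
  case: H => H /=; [apply: Or32|apply: Or32|apply: Or31]; lia.
have i1 : i.-1 < k by lia.
exists (Ordinal i1); first by rewrite cycle_relE //=; lia.
exists l.-1; first lia.
by case: H => H /=; [apply: Or31|apply: Or32|apply: Or33]; lia.
Qed.

(** * Sets of classes spreading along the cycle *)

Section CycleLevels.
Variables (s k : nat) (S : nat -> pred 'I_k).
Hypothesis kE : k = s.*2 + 5.
Hypothesis S_step : forall i c c', i < s -> cycle_rel c c' -> S i c -> S i.+1 c'.
Hypothesis S_indep : forall c c', cycle_rel c c' -> S s c -> S s c' -> False.

Lemma level_no_walk m x y (c c' : 'I_k) : x <= s -> y <= s -> x + y + m = s.*2.+1 ->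
  S x c -> S y c' -> cycle_walk k m c c' -> False.
Proof.
elim: m x y c c' => [|m IH] x y c c' xs ys E Sc Sc' W; first by lia.
have k2 : 2 < k by lia.
have mk : m < k by lia.
have [xs'|xs'] := ltnP x s.
  have [c1 cc1 W1] := cycle_walkS k2 mk W.
  by apply: (IH x.+1 y c1 c') W1 => //; [lia|exact: S_step cc1 Sc].
have [ys'|ys'] := ltnP y s.
  have [c1 cc1 W1] := cycle_walkS k2 mk (cycle_walk_sym W).
  by apply: (IH y.+1 x c1 c) W1 => //; [lia|exact: S_step cc1 Sc'].
have xE : x = s by lia.
have yE : y = s by lia.
have mE : m = 0 by lia.
move: W Sc Sc'; rewrite xE yE mE => W Sc Sc'.
have k0 : 0 < k by lia.
have [c1 cc1 [l l0 H]] := cycle_walkS k2 k0 W.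
suff c1E : c1 = c' by apply: S_indep cc1 Sc _; rewrite c1E.
apply: val_inj => /=; have := ltn_ord c1; have := ltn_ord c'.
by case: H; lia.
Qed.

(** Of the two arcs between two classes exactly one is odd. If it has length at most 2s + 1 = k - 4,
    back-and-forth steps extend it to a walk excluded by [level_no_walk]. Otherwise its length is k
    - 2 or k, and the classes are at distance 2 or 0. *)
Lemma level0_classes (c c' : 'I_k) : S 0 c -> S 0 c' ->
  [|| c == c' :> nat, c' == c + 2 :> nat, c == c' + 2 :> nat,
      c' + k == c + 2 | c + k == c' + 2].
Proof.
move=> Sc Sc'; apply/negPn/negP => H.
have ck := ltn_ord c; have ck' := ltn_ord c'.
apply: (@level_no_walk (s.*2.+1) 0 0 c c' _ _ _ Sc Sc') => //.
have [cc|cc] := leqP c c'.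
  have [o|o] := boolP (odd (c' - c)).
    by exists ((s.*2.+1 - (c' - c))./2); [|apply: Or31]; lia.
  by exists ((s.*2.+1 + k - (c' - c))./2); [|apply: Or33]; lia.
have [o|o] := boolP (odd (c - c')).
  by exists ((s.*2.+1 + (c - c'))./2); [|apply: Or31]; lia.
by exists ((s.*2.+1 - (k - (c - c')))./2); [|apply: Or32]; lia.
Qed.

(** Three classes pairwise at distance two would force k = 6, while k is odd. With exactly two
    classes, [i] is the class between them. *)
Lemma level0_cases : #|S 0| <= 1 \/ exists i, S 0 =1 cycle_rel i.
Proof.
have [|/card_gt1P[c [c' [Sc Sc' cc']]]] := leqP #|S 0| 1; [by left|right].
have k2 : 2 < k by lia.
wlog H : c c' Sc Sc' cc' / (c' == c + 2 :> nat) || (c' + k == c + 2).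
  move=> W; case/or3P: (level0_classes Sc Sc') cc' => [/eqP/val_inj->|H|/or3P[H|H|H]] cc'.
  - by rewrite eqxx in cc'.
  - by apply: W Sc Sc' _ _; rewrite ?H.
  - by apply: W Sc' Sc _ _; rewrite ?H // eq_sym.
  - by apply: W Sc Sc' _ _; rewrite ?H ?orbT.
  - by apply: W Sc' Sc _ _; rewrite ?H ?orbT // eq_sym.
have ck := ltn_ord c; have ck' := ltn_ord c'.
have ik : (if c.+1 == k then 0 else c.+1) < k by case: eqP; lia.
exists (Ordinal ik) => c''; have ck'' := ltn_ord c''.
rewrite cycle_relE //=; apply/idP/idP => [Sc''|].
  have := level0_classes Sc Sc''; have := level0_classes Sc' Sc''.
  by case: ifP; lia.
move=> E; have [->|->] // : c'' = c \/ c'' = c'.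
by case: (eqVneq (c'' : nat) c) => [|ne]; [left|right]; apply: val_inj => //=; move: E;
  case: ifP; lia.
Qed.

(** Non-adjacent classes are joined by a walk of even length 2s + 2 = k - 3. Without its end edges
    it is a walk of length 2s from a neighbour of [i] to a neighbour of [j], excluded by
    [level_no_walk] for levels 0 and 1. For [s = 0] the two neighbours coincide. *)
Lemma level_adjacent (i j : 'I_k) : (forall c, cycle_rel i c -> S 0 c) ->
  (forall c, cycle_rel j c -> if s is 0 then ~~ S 0 c else S 1 c) -> cycle_rel i j.
Proof.
move=> Si Sj; have k2 : 2 < k by lia.
have ik := ltn_ord i; have jk := ltn_ord j.
apply/negPn/negP; rewrite cycle_relE // => H.
have [c [c' [ic jc' W]]] : exists c c' : 'I_k,
    [/\ cycle_rel i c, cycle_rel j c' & cycle_walk k s.*2 c c'].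
  have [c ic Wc] : exists2 c : 'I_k, cycle_rel i c & cycle_walk k s.*2.+1 c j.
    apply: cycle_walkS; [lia|lia|].
    have [ij|ij] := leqP i j.
      have [o|o] := boolP (odd (j - i)).
        by exists ((s.*2.+2 + k - (j - i))./2); [|apply: Or33]; lia.
      by exists ((s.*2.+2 - (j - i))./2); [|apply: Or31]; lia.
    have [o|o] := boolP (odd (i - j)).
      by exists ((s.*2.+2 - (k - (i - j)))./2); [|apply: Or32]; lia.
    by exists ((s.*2.+2 + (i - j))./2); [|apply: Or31]; lia.
  have [||c' jc' Wc'] := @cycle_walkS k s.*2 j c _ _ (cycle_walk_sym Wc); [lia|lia|].
  by exists c, c'; split=> //; apply: cycle_walk_sym.
have := Sj _ jc'; case: s kE W S_step S_indep => [|s'] kE' W S_step' S_indep' S1.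
  have cc : c = c'.
    case: W => l l0 W; apply: val_inj => /=; have := ltn_ord c; have := ltn_ord c'.
    by case: W; lia.
  by rewrite -cc Si in S1.
by apply: (@level_no_walk s'.+1.*2 0 1 c c') W => //; [lia|lia|exact: Si].
Qed.
End CycleLevels.

(** * Levels and closed walks *)

Lemma card_fibers_ge (T U : finType) (Z : {set T}) (Y : {set U}) (h : T -> U) b :
  (forall y, y \in Y -> b <= #|[set z in Z | h z == y]|) -> #|Y| * b <= #|Z|.
Proof.
move=> H; rewrite -sum_nat_const -[leqRHS]sum1_card (partition_big h predT) //=.
rewrite [leqRHS](bigID [in Y]) /=; apply: leq_trans (leq_addr _ _).
apply: leq_sum => y /H /leq_trans; apply.
by rewrite -sum1_card; apply: eq_leq; apply: eq_bigl => z; rewrite inE.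
Qed.

Lemma card_bigcup_le (T U : finType) (A : T -> {set U}) :
  #|\bigcup_i A i| <= \sum_i #|A i|.
Proof.
elim/big_rec2: _ => [|i n X _ IH]; first by rewrite cards0.
by apply: leq_trans (leq_card_setU _ _) _; rewrite leq_add2l.
Qed.

(** The coordinate [l] is recovered from the other coordinates, [i] and [j] among them, and the
    position of [g l] in the enumeration of [S (g i) (g j)]. *)
Lemma card_constrained_ffun (V : finType) m b (S : V -> V -> {set V}) (l i j : 'I_m.+1) :
  l != i -> l != j -> (forall x y, #|S x y| <= b.+1) ->
  #|[set g : {ffun 'I_m.+1 -> V} | g l \in S (g i) (g j)]| <= #|V| ^ m * b.+1.
Proof.
move=> li lj Sb.
rewrite -[m in _ ^ m]card_ord -card_ffun -[b.+1]card_ord -card_prod.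
pose h (g : {ffun 'I_m.+1 -> V}) : {ffun 'I_m -> V} * 'I_b.+1 :=
  ([ffun x => g (lift l x)], inord (index (g l) (enum (S (g i) (g j))))).
apply: (@leq_card_in _ _ h) => g g'; rewrite !inE => gS gS' [/ffunP gg'].
have {}gg' x : l != x -> g x = g' x.
  by case/unlift_some => y -> _; have := gg' y; rewrite !ffunE.
rewrite -(gg' i) // -(gg' j) // in gS' * => /(congr1 val) /=.
have lt v : v \in S (g i) (g j) -> index v (enum (S (g i) (g j))) < b.+1.
  by move=> vS; rewrite (leq_trans _ (Sb (g i) (g j))) // cardE index_mem mem_enum.
rewrite !inordK ?lt // => /(congr1 (nth (g l) (enum (S (g i) (g j))))).
rewrite !nth_index ?mem_enum // => E; apply/ffunP => x.
by have [<-//|/gg'] := eqVneq l x.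
Qed.

Section Levels.
Variables (V : finType) (e : rel V) (d s : nat).
Hypothesis e_sym : symmetric e.

Fixpoint level i u : {set V} :=
  if i is j.+1 then [set x | d <= #|[set y in level j u | e y x]|] else [set x | e u x].
Arguments level : simpl never.

Lemma in_level0 u x : (x \in level 0 u) = e u x.
Proof. by rewrite inE. Qed.

Lemma in_levelS i u x :
  (x \in level i.+1 u) = (d <= #|[set y in level i u | e y x]|).
Proof. by rewrite inE. Qed.

(* The edges y x that a vertex u cannot afford in a copy it behaves well with:
   those leaving the level structure of u, and those closing a walk of length
   2s+3 whose remaining 2s vertices can be chosen in at least d^(2s) ways. *)
Definition escape_edge u y x := e y x &&
  [exists i : 'I_s, (y \in level i u) && (x \notin level i.+1 u)].
Definition closing_edge u y x := [&& e y x, y \in level s u & x \in level s u].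
Definition critical u y x := escape_edge u y x || closing_edge u y x.

(** For fixed [i], [u] and [x] outside [level i.+1 u], fewer than [d] vertices of [level i u] are
    adjacent to [x]. *)
Lemma card_escape :
  #|[set z : V * V * V | escape_edge z.1.1 z.1.2 z.2]| <= s * #|V| ^ 2 * d.
Proof.
pose A (w : 'I_s * (V * V)) := [set z : V * V * V |
  [&& z.1.1 == w.2.1, z.2 == w.2.2, e z.1.2 z.2, z.1.2 \in level w.1 z.1.1
    & z.2 \notin level w.1.+1 z.1.1]].
apply: (@leq_trans #|\bigcup_w A w|).
  apply/subset_leq_card/subsetP => -[[u y] x];
    rewrite !inE /= => /andP[yx /existsP[i /andP[yi xi]]].
  apply/bigcupP; exists (i, (u, x)) => //.
  by rewrite inE /= !eqxx yx yi xi.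
apply: leq_trans (card_bigcup_le A) _.
have -> : s * #|V| ^ 2 * d = \sum_(w : 'I_s * (V * V)) d.
  by rewrite sum_nat_const !card_prod card_ord; lia.
apply: leq_sum => -[i [u x]] _ /=.
have [xi|xi] := boolP (x \in level i.+1 u).
  rewrite [A _](_ : _ = set0) ?cards0 //; apply/setP => -[[u' y] x'].
  rewrite in_set0 in_set /=; apply/negP => /and5P[/eqP-> /eqP-> _ _].
  by rewrite xi.
apply: (@leq_trans #|[set y in level i u | e y x]|); last first.
  by move: xi; rewrite in_levelS -ltnNge => /ltnW.
apply: leq_trans (leq_imset_card (fun y => (u, y, x)) _).
apply/subset_leq_card/subsetP => -[[u' y] x']; rewrite !inE /=.
case/and5P => /eqP-> /eqP-> yx yi _.
by apply/imsetP; exists y; rewrite // inE yi yx.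
Qed.

Definition walks m u x := [set p : m.+1.-tuple V | path e u p && (last u p == x)].

(** By induction, the last vertex but one has at least [d] choices in the previous level. As [u] is
    not stored in the tuple, these walks have m + 1 edges. *)
Lemma card_walks m u x : x \in level m u -> d ^ m <= #|walks m u x|.
Proof.
elim: m x => [|m IH] x xl.
  rewrite card_gt0; apply/set0Pn; exists [tuple x].
  by move: xl; rewrite in_level0 inE /= eqxx => ->.
rewrite expnS; move: xl; rewrite in_levelS => xl.
apply: leq_trans (leq_mul xl (leqnn (d ^ m))) _.
apply: (@card_fibers_ge _ _ _ _ (fun p : m.+2.-tuple V => nth u p m)) => y.
rewrite inE => /andP[yl yx]; apply: leq_trans (IH _ yl) _.
have inj : injective (fun p : m.+1.-tuple V => [tuple of rcons p x]).
  move=> p q /(congr1 val) /= /(congr1 rev); rewrite !rev_rcons => -[].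
  by move/(congr1 rev); rewrite !revK => /val_inj.
rewrite -(card_imset _ inj); apply/subset_leq_card/subsetP => q /imsetP[p].
rewrite !inE => /andP[pp /eqP lp] ->; rewrite /= rcons_path pp lp yx last_rcons eqxx /=.
by rewrite nth_rcons size_tuple ltnSn -lp -nth_last size_tuple /= (set_nth_default (last u
  p)) // size_tuple.
Qed.

Definition closed_walks m :=
  [set g : {ffun 'I_m -> V} | [forall i, e (g i) (g (ordS i))]].

(** A closing edge yx is completed by any of at least d^s walks from u to y and d^s walks from u to
    x, each with s + 1 edges. Together with yx they form a closed walk of length 2s + 3. *)
Lemma card_closing :
  #|[set z : V * V * V | closing_edge z.1.1 z.1.2 z.2]| * d ^ s.*2
    <= #|closed_walks s.*2.+3|.
Proof.
pose W : finType := (V * (s.+1.-tuple V * s.+1.-tuple V))%type.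
pose Z := [set z : W | [&& path e z.1 z.2.1, path e z.1 z.2.2
                         & e (last z.1 z.2.1) (last z.1 z.2.2)]].
apply: (@leq_trans #|Z|).
  apply: (@card_fibers_ge _ _ _ _
    (fun z : W => (z.1, last z.1 z.2.1, last z.1 z.2.2))) => -[[u y] x].
  rewrite inE /= => /and3P[yx yl xl].
  rewrite -addnn expnD; apply: leq_trans (leq_mul (card_walks yl) (card_walks xl)) _.
  have inj : injective (fun q : s.+1.-tuple V * s.+1.-tuple V => (u, q) : W).
    by move=> p q [].
  rewrite -cardsX -(card_imset _ inj).
  apply/subset_leq_card/subsetP => _ /imsetP[[p q] + ->].
  rewrite !inE /= => /andP[/andP[pp /eqP lp] /andP[pq /eqP lq]].
  by rewrite pp pq lp lq yx !eqxx.
(* The closed walk follows the first walk from [u] and returns along the second. *)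
pose c (z : W) := z.1 :: z.2.1 ++ rev z.2.2.
have sc z : size (c z) = s.*2.+3 by rewrite /c /= size_cat size_rev !size_tuple; lia.
pose h (z : W) : {ffun 'I_(s.*2.+3) -> V} := [ffun i : 'I__ => nth z.1 (c z) i].
have h_inj : injective h.
  move=> z z' /ffunP E.
  have {}E : c z = c z'.
    apply: (@eq_from_nth _ z.1) => [|i]; rewrite ?sc // => ilt.
    have := E (Ordinal ilt); rewrite !ffunE /= => ->.
    by apply: set_nth_default; rewrite sc.
  case: z z' E => u [p p'] [v [q q']] [-> /eqP].
  rewrite eqseq_cat ?size_tuple // => /andP[/eqP pq /eqP/(congr1 rev)].
  by rewrite !revK => pq'; congr (_, (_, _)); apply: val_inj.
rewrite -(card_imset _ h_inj); apply/subset_leq_card/subsetP => g /imsetP[z + ->].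
rewrite !in_set => /and3P[p1 p2 p12]; apply/forallP => i.
have /(pathP z.1) : cycle e (c z).
  rewrite /c /= rcons_cat -rev_cons lastI rev_rcons cat_path /= p1 p12 /=.
  by rewrite rev_path (eq_path (e' := e)).
move: (sc z); rewrite /c /= size_rcons => -[q_size] /(_ i); rewrite q_size.
rewrite nth_rcons !ffunE /= q_size => /(_ (ltn_ord i)); have := ltn_ord i.
rewrite leq_eqVlt => /predU1P[iE|iE].
  have -> : i = s.*2.+2 :> nat by case: iE.
  by rewrite modnn ltnn eqxx -rcons_cons nth_rcons /= q_size ltnSn.
have i' : i < s.*2.+2 by [].
by rewrite modn_small // i' -rcons_cons nth_rcons /= q_size ltnS (ltnW i').
Qed.

End Levels.
Arguments level : simpl never.

(** * Families of copies *)

Lemma card_tblowup_class G t (c : vertex G) : #|[set p : tblowup G t | tag p == c]| = t.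
Proof.
have inj : injective (fun i : 'I_t => Tagged (fun _ => 'I_t) i : tblowup G t).
  by move=> c' i j /eqP; rewrite eq_Tagged => /eqP.
rewrite -[RHS]card_ord -cardsT -(card_imset _ (inj c)); congr #|pred_of_set _|.
apply/setP => -[c' i]; rewrite inE /=; apply/eqP/imsetP => [->|[j _ [-> _]] //].
by exists i.
Qed.

Lemma card_tblowup G t : #|tblowup G t| = #|G| * t.
Proof.
rewrite card_tagged sumnE big_map big_enum /= (eq_bigr (fun=> t)) ?sum_nat_const //.
by move=> c _; rewrite card_ord.
Qed.

Lemma card_cycle_neighbours k (i : 'I_k) : 2 < k -> #|[set j | cycle_rel i j]| = 2.
Proof.
move=> k2; have ik := ltn_ord i.
have Hs : (if i.+1 == k then 0 else i.+1) < k by case: eqP; lia.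
have Hp : (if i == 0 :> nat then k.-1 else i.-1) < k by case: eqP; lia.
rewrite (_ : [set j | _] = [set Ordinal Hs; Ordinal Hp]).
  by rewrite cards2 -val_eqE /=; do 3 case: eqP; lia.
apply/setP => j; rewrite !inE cycle_relE // -!val_eqE /=.
by have := ltn_ord j; do 2 case: ifP; lia.
Qed.

Lemma card_tblowup_neighbours k t (p : tblowup (cycle_graph k) t) : 2 < k ->
  #|[set q | adj p q]| = t.*2.
Proof.
move=> k2; rewrite -sum1_card (partition_big (fun q => tag q) [in [set j | cycle_rel (tag
  p) j]]).
  rewrite -[in RHS]muln2 mulnC -(card_cycle_neighbours (tag p) k2) -sum_nat_const.
  apply: eq_bigr => c; rewrite inE => pc.
  rewrite -[RHS](card_tblowup_class t (c : vertex (cycle_graph k))) -sum1_card.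
  apply: eq_bigl => q; rewrite !inE /=.
  by case: eqP => [qc|]; rewrite ?andbF // /blowup_rel /= qc pc.
by move=> q; rewrite !inE.
Qed.

Definition class_point k t (t_gt0 : 0 < t) (c : 'I_k) : tblowup (cycle_graph k) t :=
  Tagged (fun _ => 'I_t) (Ordinal t_gt0 : 'I_t) (i := c).

Lemma sum_sqr_le (T : finType) (f : T -> nat) :
  (\sum_x f x) ^ 2 <= #|T| * \sum_x f x ^ 2.
Proof.
rewrite -(leq_pmul2l (isT : 0 < 2)) -mulnn.
have -> : 2 * ((\sum_x f x) * \sum_x f x) = \sum_x \sum_y 2 * (f x * f y).
  rewrite big_distrlr /= big_distrr /=; apply: eq_bigr => x _.
  by rewrite big_distrr.
have -> : 2 * (#|T| * \sum_x f x ^ 2) = \sum_x \sum_y (f x ^ 2 + f y ^ 2).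
  transitivity (\sum_x (#|T| * f x ^ 2 + \sum_y f y ^ 2)).
    by rewrite big_split /= -big_distrr /= sum_nat_const mul2n addnn.
  by apply: eq_bigr => x _; rewrite big_split /= sum_nat_const.
by apply: leq_sum => x _; apply: leq_sum => y _; apply: nat_Cauchy.
Qed.

Section Copies.
Variables (k t : nat).
Hypothesis k_gt2 : 2 < k.
Notation F := (tblowup (cycle_graph k) t).
Variables (V I : finType) (phi : I -> F -> V).
Hypothesis phi_inj : forall a, injective (phi a).

Definition in_copy a x y :=
  [exists p : F, exists q : F, [&& adj p q, phi a p == x & phi a q == y]].
Definition union_adj x y := [exists a, in_copy a x y].
Definition multiplicity x := \sum_a (x \in codom (phi a)).
Definition contacts v a := \sum_p union_adj v (phi a p).

Hypothesis in_copy_uniq : forall a b x y, in_copy a x y -> in_copy b x y -> a = b.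

Local Notation e := union_adj.
Local Notation n := #|V|.

Lemma in_copyP a x y :
  reflect (exists p q, [/\ adj p q, phi a p = x & phi a q = y]) (in_copy a x y).
Proof.
apply: (iffP existsP) => [[p /existsP[q /and3P[pq /eqP px /eqP qy]]]|[p [q [pq px qy]]]].
  by exists p, q.
by exists p; apply/existsP; exists q; rewrite pq px qy !eqxx.
Qed.

Lemma in_copy_sym a x y : in_copy a x y = in_copy a y x.
Proof.
by apply/in_copyP/in_copyP => -[p [q [pq <- <-]]]; exists q, p; rewrite adj_sym.
Qed.

Lemma union_adj_sym : symmetric e.
Proof. by move=> x y; apply: eq_existsb => a; rewrite in_copy_sym. Qed.

Lemma in_copy_union a p q : adj p q -> e (phi a p) (phi a q).
Proof. by move=> pq; apply/existsP; exists a; apply/in_copyP; exists p, q. Qed.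

Lemma sum_in_copy x y : \sum_a in_copy a x y = e x y.
Proof.
case: (boolP (e x y)) => [/existsP[a xy]|/existsPn H].
  rewrite (bigD1 a) //= xy big1 // => b ba; case: (boolP (in_copy b x y)) => // bxy.
  by rewrite (in_copy_uniq xy bxy) eqxx in ba.
by rewrite big1 // => a _; rewrite (negPf (H a)).
Qed.

Lemma sum_phi a (f : V -> nat) : \sum_p f (phi a p) = \sum_x (x \in codom (phi a)) * f x.
Proof.
transitivity (\sum_(x in phi a @: [set: F]) f x).
  by rewrite big_imset => [|p q _ _ /phi_inj //]; apply: eq_bigl => p; rewrite inE.
rewrite big_mkcond; apply: eq_bigr => x _.
have -> : (x \in phi a @: [set: F]) = (x \in codom (phi a)).
  by apply/imsetP/codomP => [[p _ ->]|[p ->]]; exists p.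
by case: (x \in _); rewrite ?mul1n ?mul0n.
Qed.

(** Every copy through [x] uses 2t edges at [x], and no edge belongs to two copies. *)
Lemma multiplicity_le_degree x : t.*2 * multiplicity x <= \sum_y e x y.
Proof.
under eq_bigr => y _ do rewrite -sum_in_copy.
rewrite exchange_big big_distrr /=; apply: leq_sum => a _.
have [/codomP[p ->]|] := boolP (x \in codom _); last by rewrite muln0.
rewrite muln1 -(card_tblowup_neighbours p k_gt2) -(card_imset _ (@phi_inj a)).
rewrite -sum1_card big_mkcond; apply: leq_sum => y _ /=.
by case: imsetP => // -[q]; rewrite inE => pq ->; rewrite lt0b; apply/in_copyP; exists p, q.
Qed.

Lemma multiplicity_le x : t.*2 * multiplicity x <= n.
Proof.
apply: leq_trans (multiplicity_le_degree x) _.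
by rewrite -sum1_card; apply: leq_sum => y _; apply: leq_b1.
Qed.

Lemma sum_multiplicity : \sum_x multiplicity x = k * t * #|I|.
Proof.
rewrite exchange_big mulnC -sum_nat_const; apply: eq_bigr => a _ /=.
have := sum_phi a (fun=> 1); rewrite sum_nat_const card_tblowup card_ord muln1 => ->.
by apply: eq_bigr => x _; rewrite muln1.
Qed.

(** The double sum equals the sum over x of multiplicity times degree, hence is at least 2t times
    the sum of the squared multiplicities, to which Cauchy-Schwarz applies. *)
Lemma sum_contacts_ge :
  t.*2 * (k * t * #|I|) ^ 2 <= n * \sum_a \sum_v contacts v a.
Proof.
rewrite -sum_multiplicity.
apply: leq_trans (leq_mul (leqnn _) (sum_sqr_le _)) _.
rewrite mulnCA leq_mul2l; apply/orP; right.
have -> : \sum_a \sum_v contacts v a = \sum_x multiplicity x * \sum_y e x y.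
  under [RHS]eq_bigr => x _ do rewrite big_distrl /=.
  rewrite [RHS]exchange_big /=; apply: eq_bigr => a _.
  rewrite -(sum_phi a (fun x => \sum_y e x y)) exchange_big /=.
  by apply: eq_bigr => p _; apply: eq_bigr => v _; rewrite union_adj_sym.
rewrite big_distrr /=; apply: leq_sum => x _.
rewrite -mulnn mulnA mulnC leq_mul2l; apply/orP; right.
exact: multiplicity_le_degree.
Qed.

(** * Critical configurations and the copies to delete *)

Variables (s d : nat).
Hypothesis kE : k = s.*2 + 5.
Hypothesis t_gt0 : 0 < t.

Local Notation crit := (critical e d s).

Definition bad v a := [exists p, exists q, adj p q && crit v (phi a p) (phi a q)].
Definition bad_edge a u v := [exists p, crit u v (phi a p)].
Definition low v a := bad v a || (contacts v a < t.*2).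
(** A copy outside this set has only vertices that occupy a definite class relative to [a], and only
    edges that respect these classes. *)
Definition deleted a := [set b |
  [exists x, low x a && (x \in codom (phi b))]
  || [exists u, exists v, in_copy b u v && bad_edge a u v]].
Definition num_critical := \sum_u \sum_y \sum_x crit u y x.

Lemma critical_adj u y x : crit u y x -> e y x.
Proof. by case/orP => [/andP[]|/and3P[]]. Qed.

(** A bad pair is charged to a critical triple whose edge lies in the copy; that edge determines the
    copy. *)
Lemma sum_bad : \sum_a \sum_v bad v a <= num_critical.
Proof.
rewrite exchange_big; apply: leq_sum => u _.
apply: (@leq_trans (\sum_a \sum_y \sum_x (crit u y x && in_copy a y x))).
  apply: leq_sum => a _; have [/existsP[p /existsP[q /andP[pq c]]]|//] := boolP (bad u a).
  rewrite (bigD1 (phi a p)) //= (bigD1 (phi a q)) //= c.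
  by have -> : in_copy a (phi a p) (phi a q) by apply/in_copyP; exists p, q.
rewrite exchange_big; apply: leq_sum => y _; rewrite exchange_big; apply: leq_sum => x _ /=.
have [c|] := boolP (crit u y x); last by rewrite big1.
by rewrite /= sum_in_copy (critical_adj c).
Qed.

(** A critical triple (u, v, x) is charged only by copies through x, of which there are at most
    n/(2t). *)
Lemma sum_bad_edge : t.*2 * (\sum_a \sum_u \sum_v bad_edge a u v) <= n * num_critical.
Proof.
apply: (@leq_trans (t.*2 * \sum_u \sum_v \sum_x multiplicity x * crit u v x)).
  rewrite leq_mul2l; apply/orP; right.
  rewrite exchange_big; apply: leq_sum => u _.
  rewrite exchange_big; apply: leq_sum => v _ /=.
  under [leqRHS]eq_bigr => x _ do rewrite big_distrl /=.
  rewrite [leqRHS]exchange_big; apply: leq_sum => a _ /=.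
  have [/existsP[p c]|//] := boolP (bad_edge a u v); rewrite (bigD1 (phi a p)) //= c.
  by rewrite codom_f.
rewrite /num_critical !big_distrr; apply: leq_sum => u _.
rewrite !big_distrr; apply: leq_sum => v _.
rewrite !big_distrr; apply: leq_sum => x _ /=.
by rewrite mulnA leq_mul2r multiplicity_le orbT.
Qed.

Definition class_level a u i : pred 'I_k :=
  [pred c | [exists p : F, (tag p == c) && (phi a p \in level e d i u)]].

Lemma class_levelP a u i c :
  reflect (exists2 p : F, tag p = c & phi a p \in level e d i u) (class_level a u i c).
Proof.
apply: (iffP existsP) => [[p /andP[/eqP pc pl]]|[p pc pl]]; exists p => //.
by rewrite pc eqxx.
Qed.

(** One vertex of class [c] in level [i] is adjacent to every vertex of class [c'], and no edge of
    the copy escapes; so any representative of [c'] lies in the next level. *)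
Lemma class_level_step a u i c c' : ~~ bad u a -> i < s -> cycle_rel c c' ->
  class_level a u i c -> class_level a u i.+1 c'.
Proof.
move=> nb lis cc' /class_levelP[p pc pl].
pose q := class_point t_gt0 c'.
apply/class_levelP; exists q => //; apply: contraNT nb => ql.
have pq : adj p q by rewrite /= /blowup_rel /= pc.
apply/existsP; exists p; apply/existsP; exists q; rewrite pq /=.
apply/orP; left; rewrite /escape_edge in_copy_union //=.
by apply/existsP; exists (Ordinal lis); rewrite pl.
Qed.

Lemma class_level_indep a u c c' : ~~ bad u a -> cycle_rel c c' ->
  class_level a u s c -> class_level a u s c' -> False.
Proof.
move=> /negP nb cc' /class_levelP[p pc pl] /class_levelP[q qc ql]; apply: nb.
have pq : adj p q by rewrite /= /blowup_rel /= pc qc.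
apply/existsP; exists p; apply/existsP; exists q; rewrite pq /=.
by apply/orP; right; rewrite /closing_edge in_copy_union ?pl.
Qed.

Lemma contacts_le_classes u a : contacts u a <= #|class_level a u 0| * t.
Proof.
rewrite -sum_nat_const /contacts (partition_big (fun p : F => tag p) predT) //=.
rewrite [leqRHS]big_mkcond; apply: leq_sum => c _ /=.
have [_|/negP nc] := boolP (c \in _).
  rewrite -[leqRHS](card_tblowup_class t (c : vertex (cycle_graph k))) -sum1_card.
  rewrite (eq_bigl (fun p : F => tag p == c)) => [|p]; last by rewrite inE.
  by apply: leq_sum => p _; apply: leq_b1.
rewrite big1 // => p /eqP pc; apply/eqP; rewrite eqb0; apply/negP => up; apply: nc.
by apply/class_levelP; exists p; rewrite ?in_level0.
Qed.

Lemma contacts_le u a : ~~ bad u a -> contacts u a <= t.*2.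
Proof.
move=> nb; apply: leq_trans (contacts_le_classes u a) _.
rewrite -mul2n leq_mul2r; apply/orP; right.
case: (level0_cases kE (fun i c c' => class_level_step nb) (fun c c' => class_level_indep
  nb)) => [/leq_trans-> //|[i Ei]].
rewrite -(card_cycle_neighbours i k_gt2) (eq_card (B := [set j | cycle_rel i j])) // => c.
by rewrite inE -Ei.
Qed.

(** Towards the copy, [u] then behaves like a vertex of class [i]. *)
Definition centre_class a u i := [forall p : F, cycle_rel i (tag p) ==> e u (phi a p)].

(** One class supplies at most t of the 2t contacts, so [level0_cases] yields the two classes around
    some [i], and 2t contacts fill both. *)
Lemma centre_class_exists u a : ~~ low u a -> exists i, centre_class a u i.
Proof.
rewrite negb_or -leqNgt => /andP[nb ge].
have le := contacts_le_classes u a.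
case: (level0_cases kE (fun i c c' => class_level_step nb) (fun c c' => class_level_indep
  nb)) => [c1|[i Ei]].
  have := leq_trans ge le; nia.
exists i; apply/forallP => p; apply/implyP => ip; apply: contraTT ge => np.
rewrite -ltnNge -(card_tblowup_neighbours (class_point t_gt0 i) k_gt2).
rewrite -sum1_card (bigD1 p) ?inE //= /contacts (bigD1 p) //= (negPf np) add0n add1n ltnS.
rewrite [leqRHS]big_mkcond [leqLHS]big_mkcond; apply: leq_sum => q _ /=.
have [->|qp] //= := eqVneq q p.
rewrite andbT inE /= /blowup_rel /=; have [uq|//] := boolP (e u (phi a q)).
suff -> : cycle_rel i (tag q) by [].
by rewrite -Ei; apply/class_levelP; exists q; rewrite ?in_level0.
Qed.

(** As [v] is in level 0 of [u], the neighbours of [v] in the copy lie in level 1, since no edge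
    from [v] into the copy escapes. For [s = 0] they avoid level 0 instead, since no such edge
    closes. Then [level_adjacent] applies. *)
Lemma centre_class_adj a u v i j : ~~ bad u a -> ~~ bad_edge a u v -> e u v ->
  centre_class a u i -> centre_class a v j -> cycle_rel i j.
Proof.
move=> nb /existsPn ne uv /forallP Ci /forallP Cj.
have adjC p : cycle_rel j (tag p) -> e v (phi a p) by move=> jp; apply: (implyP (Cj p)).
apply: (level_adjacent kE (fun i c c' => class_level_step nb) (fun c c' =>
  class_level_indep nb)) => c ic.
  pose q := class_point t_gt0 c.
  by apply/class_levelP; exists q => //; rewrite in_level0; apply: (implyP (Ci q)).
case: (posnP s) => [s0|s0].
  rewrite s0; apply/negP => /class_levelP[p pc up]; have /negP := ne p; apply.
  apply/orP; right; rewrite /closing_edge adjC ?pc // s0 up in_level0 uv //.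
have -> : class_level a u 1 c; last by case: (s) s0.
pose q := class_point t_gt0 c.
apply/class_levelP; exists q => //; apply/negPn/negP => ql; have /negP := ne q; apply.
apply/orP; left; rewrite /escape_edge adjC //=; apply/existsP; exists (Ordinal s0) => /=.
by rewrite in_level0 uv.
Qed.

Lemma deletion_homomorphism a : exists h : V -> 'I_k,
  forall b x y, b \notin deleted a -> in_copy b x y -> cycle_rel (h x) (h y).
Proof.
have k0 : 0 < k by lia.
(* The default is taken only at vertices without a centre class; these are low, so no surviving copy
   contains them. *)
exists (fun x => odflt (Ordinal k0) [pick i | centre_class a x i]) => b x y.
rewrite inE negb_or => /andP[/existsPn nl /existsPn nbe] bxy.
have cc z : z \in codom (phi b) ->
    ~~ low z a /\ centre_class a z (odflt (Ordinal k0) [pick i | centre_class a z i]).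
  move=> zb; have := nl z; rewrite zb andbT => nlz; split=> //.
  by case: pickP => // H; have [i] := centre_class_exists nlz; rewrite H.
have [p [q [pq px qy]]] := in_copyP _ _ _ bxy.
have [lx cx] : _ /\ _ := cc x (introT codomP (ex_intro _ p (esym px))).
have [_ cy] : _ /\ _ := cc y (introT codomP (ex_intro _ q (esym qy))).
move: lx; rewrite negb_or => /andP[nbx _].
apply: (centre_class_adj nbx _ _ cx cy).
  by have /existsPn/(_ y) := nbe x; rewrite bxy.
by apply/existsP; exists b.
Qed.

(** A low vertex removes at most n/(2t) copies and a bad edge at most one. *)
Lemma card_deleted a :
  t.*2 * #|deleted a| <= n * (\sum_v low v a) + t.*2 * (\sum_u \sum_v bad_edge a u v).
Proof.
apply: (@leq_trans (t.*2 * (\sum_v low v a * multiplicity v + \sum_u \sum_v bad_edge a u v))).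
  rewrite leq_mul2l; apply/orP; right.
  apply: (@leq_trans (\sum_b (\sum_v low v a * (v \in codom (phi b))
                            + \sum_u \sum_v bad_edge a u v * in_copy b u v))).
    rewrite -sum1_card big_mkcond; apply: leq_sum => b _; rewrite inE.
    case: (boolP [exists x, _]) => [/existsP[x /andP[lx xb]]|_] /=.
      by rewrite (bigD1 x) //= lx xb.
    case: (boolP [exists u, _]) => [/existsP[u /existsP[v /andP[uv buv]]]|_] //.
    by rewrite addnC (bigD1 u) //= (bigD1 v) //= uv buv.
  rewrite big_split /= leq_add //.
    by rewrite exchange_big /=; apply: leq_sum => v _; rewrite big_distrr.
  rewrite exchange_big; apply: leq_sum => u _; rewrite exchange_big; apply: leq_sum => v _ /=.
  by rewrite -big_distrr /= sum_in_copy; case: (bad_edge a u v); case: (e u v).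
rewrite mulnDr leq_add2r !big_distrr /=; apply: leq_sum => v _.
by rewrite mulnCA mulnC leq_mul2r multiplicity_le orbT.
Qed.

(** A vertex that is not bad contributes at most 2t, because being low costs it a contact. A bad
    vertex contributes at most kt contacts and one unit for being low. *)
Lemma sum_contacts_le a :
  \sum_v contacts v a + \sum_v low v a <= t.*2 * n + (k * t).+1 * \sum_v bad v a.
Proof.
rewrite -big_split big_distrr /= mulnC -sum_nat_const -big_split /=.
apply: leq_sum => v _; rewrite /low.
case: (boolP (bad v a)) => [_|nb] /=; last first.
  by have := contacts_le nb; case: leqP; lia.
have : contacts v a <= k * t.
  have <- : #|F| = k * t by rewrite card_tblowup card_ord.
  by rewrite -sum1_card; apply: leq_sum => p _; apply: leq_b1.
lia.
Qed.

(** Adding [card_deleted] and [sum_contacts_le] over all [a] cancels the low vertices, and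
    [sum_contacts_ge] removes the contacts. Without the first term this bounds the number of copies;
    for nearly that many copies it makes the average deletion small. *)
Lemma sum_deleted : \sum_a #|deleted a| + (k * t) ^ 2 * #|I| ^ 2
  <= n ^ 2 * #|I| + (k * t).+2 * n * num_critical.
Proof.
have H1 : t.*2 * \sum_a #|deleted a| <= n * (\sum_a \sum_v low v a) + n * num_critical.
  apply: leq_trans (leq_add (leqnn _) sum_bad_edge).
  by rewrite !big_distrr -big_split /=; apply: leq_sum => a _; apply: card_deleted.
have H2 : \sum_a \sum_v contacts v a + \sum_a \sum_v low v a
    <= #|I| * (t.*2 * n) + (k * t).+1 * num_critical.
  apply: leq_trans (leq_add (leqnn _) (leq_mul (leqnn _) sum_bad)).
  by rewrite big_distrr -sum_nat_const -!big_split /=; apply: leq_sum => a _;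
    apply: sum_contacts_le.
have H3 := sum_contacts_ge.
have {}H2 := leq_mul (leqnn n) H2.
have t2 : 0 < t.*2 by lia.
rewrite -(leq_pmul2l t2); move: H1 H2 H3.
set D := \sum_a #|_|; set L := \sum_a \sum_v low v a; set S := \sum_a \sum_v contacts v a.
move: num_critical D L S #|I| => C D L S m H1 H2 H3.
have : n * C <= t.*2 * (n * C) by apply: leq_pmull.
nia.
Qed.

(** * Closed walks when no cycle is rainbow *)

Definition no_rainbow_cycle m := forall g : 'I_m -> V, injective g ->
  (forall i, e (g i) (g (ordS i))) ->
  exists i j a, [/\ i != j, in_copy a (g i) (g (ordS i)) & in_copy a (g j) (g (ordS j))].

(** A closed walk repeats a vertex or has two edges in one copy. Either way one coordinate lies in a
    set of at most kt + 1 vertices determined by two others: [S x y] consists of [x] and the copy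
    through xy. *)
Lemma card_closed_walks m : 1 < m -> no_rainbow_cycle m.+1 ->
  #|closed_walks e m.+1| <= m.+1 ^ 3 * (n ^ m * (k * t).+1).
Proof.
move=> m1 nr.
pose S x y := x |: \bigcup_(a | in_copy a x y) [set phi a p | p : F].
have S_card x y : #|S x y| <= (k * t).+1.
  apply: leq_trans (leq_card_setU _ _) _; rewrite cards1 add1n ltnS.
  have [/existsP[a xy]|/existsPn H] := boolP (e x y); last first.
    by rewrite big1 ?cards0 // => a; rewrite (negPf (H a)).
  rewrite (big_pred1 a) => [|b]; last first.
    by apply/idP/eqP => [bxy|-> //]; apply: in_copy_uniq bxy xy.
  apply: leq_trans (leq_imset_card _ _) _.
  by rewrite -[k in _ <= k * _]card_ord -(card_tblowup (cycle_graph k)) max_card.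
pose A (w : 'I_m.+1 * 'I_m.+1 * 'I_m.+1) := [set g : {ffun 'I_m.+1 -> V} |
  [&& w.1.1 != w.1.2, w.1.1 != w.2 & g w.1.1 \in S (g w.1.2) (g w.2)]].
apply: (@leq_trans #|\bigcup_w A w|); last first.
  apply: leq_trans (card_bigcup_le A) _.
  have -> : m.+1 ^ 3 = #|{: 'I_m.+1 * 'I_m.+1 * 'I_m.+1}|.
    by rewrite !card_prod card_ord; lia.
  rewrite -sum_nat_const; apply: leq_sum => -[[l i] j] _.
  have [li|li] := eqVneq l i.
    by rewrite [A _](_ : _ = set0) ?cards0 //; apply/setP => g; rewrite !inE /= li eqxx.
  have [lj|lj] := eqVneq l j.
    by rewrite [A _](_ : _ = set0) ?cards0 //; apply/setP => g; rewrite !inE /= lj eqxx andbF.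
  apply: leq_trans (card_constrained_ffun li lj S_card).
  by apply/subset_leq_card/subsetP => g; rewrite !in_set => /and3P[].
apply/subset_leq_card/subsetP => g; rewrite inE => /forallP ge.
have [/injectiveP g_inj|/injectivePn[l [i li gli]]] := boolP (injectiveb g); last first.
  apply/bigcupP; exists (l, i, i) => //; rewrite inE /= li /=.
  by rewrite gli setU11.
have [i [j [a [ij ai aj]]]] := nr g g_inj ge.
have ordSS_neq (x : 'I_m.+1) : ordS (ordS x) != x.
  rewrite -val_eqE /=; have := ltn_ord x => xm.
  have [x1|x1] := ltnP x.+1 m.+1.
    rewrite (modn_small x1); have [x2|x2] := ltnP x.+2 m.+1; first by rewrite modn_small; lia.
    have -> : x.+2 = m.+1 by lia.
    by rewrite modnn; lia.
  have -> : x.+1 = m.+1 by lia.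
  by rewrite modnn modn_small; lia.
have in_S l : (exists p, phi a p = g l) -> g l \in S (g i) (g (ordS i)).
  move=> [p <-]; rewrite inE; apply/orP; right; apply/bigcupP; exists a => //.
  exact: imset_f.
have [p [q [_ pj qj]]] := in_copyP _ _ _ aj.
(* The constrained coordinate must differ from [i] and [ordS i]: it is [j], or the far end [ordS j]
   when [j] equals [ordS i]. *)
have [jS|jS] := eqVneq j (ordS i).
  apply/bigcupP; exists (ordS j, i, ordS i) => //; rewrite inE /= in_S; last by exists q.
  by rewrite jS ordSS_neq ordS_neq // ltnW.
apply/bigcupP; exists (j, i, ordS i) => //; rewrite inE /= in_S; last by exists p.
by rewrite jS eq_sym ij.
Qed.

Lemma num_critical_le : no_rainbow_cycle s.*2.+3 ->
  num_critical * d ^ s.*2 <= s * n ^ 2 * d * d ^ s.*2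
    + s.*2.+3 ^ 3 * (n ^ s.*2.+2 * (k * t).+1).
Proof.
move=> nr.
have -> : num_critical = #|[set z : V * V * V | crit z.1.1 z.1.2 z.2]|.
  rewrite -sum1_card big_mkcond /num_critical.
  rewrite pair_big pair_big; apply: eq_bigr => z _; rewrite inE /=.
  by case: (crit _ _ _).
apply: leq_trans _ (leq_add (leq_mul (card_escape e d s) (leqnn _))
  (leq_trans (card_closing d s union_adj_sym) (@card_closed_walks s.*2.+2 isT nr))).
rewrite -mulnDl leq_mul2r; apply/orP; right.
apply: leq_trans (leq_card_setU _ _); apply/subset_leq_card/subsetP => z.
by rewrite !inE.
Qed.

End Copies.

(** * Choice of the threshold and of the reference copy *)

Lemma exists_le_mean (I : finType) (f : I -> nat) : 0 < #|I| ->
  exists a, f a * #|I| <= \sum_b f b.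
Proof.
case/card_gt0P => a0 _; have [a _ min_a] := arg_minnP f (isT : xpredT a0).
by exists a; rewrite mulnC -sum_nat_const; apply: leq_sum => b _; apply: min_a.
Qed.

(** With d = n/q rounded down and q just above 2Qs, the escape term times Q is at most n^3/2. As d
    is still linear in n, dividing n^(2s+2) by d^(2s) leaves O(n^2). *)
Lemma small_escape_threshold s Q K : exists N, forall n C, N < n ->
  (forall d, C d * d ^ s.*2 <= s * n ^ 2 * d * d ^ s.*2 + K * n ^ s.*2.+2) ->
  exists d, Q * C d <= n ^ 3.
Proof.
pose q := 2 * Q * s + 1.
exists (q + 2 * Q * (K * (2 * q) ^ s.*2)) => n C Nn H.
pose d := n %/ q; exists d.
have q0 : 0 < q by rewrite /q addn1.
have d0 : 0 < d by rewrite divn_gt0 //; lia.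
have dn : d * q <= n by apply: leq_trunc_div.
have nd : n <= 2 * q * d.
  have := ltn_ceil n q0; rewrite -/d => lt; have : q <= d * q by apply: leq_pmull.
  lia.
have {}H : C d <= s * n ^ 2 * d + K * (2 * q) ^ s.*2 * n ^ 2.
  have dd : 0 < d ^ s.*2 by rewrite expn_gt0 d0.
  rewrite -(leq_pmul2r dd); apply: leq_trans (H d) _.
  rewrite mulnDl leq_add2l -addn2 expnD.
  have : n ^ s.*2 <= (2 * q) ^ s.*2 * d ^ s.*2.
    by rewrite -expnMn; case: (posnP s.*2) => [->//|s0]; rewrite leq_exp2r.
  move/(leq_mul (leqnn (K * n ^ 2))); lia.
have H1 : n ^ 2 * (2 * Q * s * d) <= n ^ 3.
  rewrite [n ^ 3]expnSr leq_mul2l; apply/orP; right.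
  by apply: leq_trans dn; rewrite mulnC leq_mul2l /q addn1 leqnSn orbT.
have H2 : n ^ 2 * (2 * Q * (K * (2 * q) ^ s.*2)) <= n ^ 3.
  by rewrite [n ^ 3]expnSr leq_mul2l; apply/orP; right; lia.
have := leq_mul (leqnn (2 * Q)) H; lia.
Qed.

Lemma copies_stability s t Q : let k := s.*2 + 5 in 0 < t -> exists N,
  forall (V I : finType) (phi : I -> tblowup (cycle_graph k) t -> V),
  N < #|V| -> (forall a, injective (phi a)) ->
  (forall a b x y, in_copy phi a x y -> in_copy phi b x y -> a = b) ->
  no_rainbow_cycle phi s.*2.+3 -> 0 < #|I| ->
  exists (D : {set I}) (h : V -> 'I_k),
    Q * (#|D| * #|I| + (k * t) ^ 2 * #|I| ^ 2) <= Q * #|V| ^ 2 * #|I| + #|V| ^ 4 /\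
    forall b x y, b \notin D -> in_copy phi b x y -> cycle_rel (h x) (h y).
Proof.
move=> k t_gt0.
(* The factor [(k * t).+2] is the one before [num_critical] in [sum_deleted]; that term times [Q]
   then stays below n^4. *)
have [N HN] := small_escape_threshold s (Q * (k * t).+2) (s.*2.+3 ^ 3 * (k * t).+1).
exists N => V I phi nV phi_inj uniq nr I0.
have k2 : 2 < k by rewrite /k; lia.
have [|d Hd] := HN #|V| (num_critical phi s) nV.
  move=> d; apply: leq_trans (num_critical_le k2 uniq d (erefl k) t_gt0 nr) _.
  by rewrite leq_add2l -mulnA [_ * (_ ^ _)]mulnC.
have [a Ha] := exists_le_mean (fun a => #|deleted phi s d a|) I0.
have [h hP] := deletion_homomorphism k2 phi d (erefl k) t_gt0 a.
exists (deleted phi s d a), h; split=> //.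
have := sum_deleted k2 phi_inj uniq d (erefl k) t_gt0.
move: Ha Hd; set X := \sum_b _; set C := num_critical _ _ _ => Ha Hd HX.
apply: (@leq_trans (Q * (X + (k * t) ^ 2 * #|I| ^ 2))).
  by rewrite leq_mul2l leq_add2r Ha orbT.
apply: leq_trans (leq_mul (leqnn Q) HX) _.
have := leq_mul (leqnn #|V|) Hd; rewrite -expnS => {}Hd.
rewrite mulnDr; lia.
Qed.

(** * From edge sets to embeddings *)

Lemma edgesP (G : sgraph) (E : {set G}) :
  reflect (exists p q, adj p q /\ E = [set p; q]) (E \in edges G).
Proof.
apply: (iffP imsetP) => [[[p q] pq ->]|[p [q [pq ->]]]]; last first.
  by exists (p, q); rewrite ?inE.
by exists p, q; move: pq; rewrite inE.
Qed.

Lemma imset_pair (T U : finType) (f : T -> U) x y : f @: [set x; y] = [set f x; f y].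
Proof. by rewrite imsetU1 imset_set1. Qed.

Lemma copy_edgeP (F : sgraph) (V : finType) (f : F -> V) x y : injective f ->
  reflect (exists p q, [/\ adj p q, f p = x & f q = y])
          ([set x; y] \in [set f @: E | E : {set F} in edges F]).
Proof.
move=> f_inj; apply: (iffP imsetP) => [[_ /edgesP[p [q [pq ->]]]]|[p [q [pq <- <-]]]];
  last first.
  by exists [set p; q]; [apply/edgesP; exists p, q | rewrite imset_pair].
rewrite imset_pair => E.
have fpq : f p != f q by apply: contraTneq pq => /f_inj->; rewrite adj_irr.
have xy : x != y.
  by apply: contraNneq fpq => xy; have := congr1 (fun S : {set V} => #|S|) E;
    rewrite xy setUid cards1 cards2; case: eqP.
have : (f p \in [set x; y]) && (f q \in [set x; y]) by rewrite E !inE !eqxx orbT.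
rewrite !inE => /andP[/orP[]/eqP fp /orP[]/eqP fq]; rewrite fp fq ?eqxx // in fpq *.
  by exists p, q.
by exists q, p; rewrite adj_sym.
Qed.

(** An embedding is chosen for each member of [A]. Disjointness becomes uniqueness of the copy
    through an edge, and a repeated colour becomes two edges in one copy. *)
Lemma family_stability k t Q : 4 < k -> odd k -> 0 < t -> exists N,
  forall (V : finType) (A : {set {set {set V}}}), N < #|V| ->
  trivIset A -> {in A, forall B, is_copy (tblowup (cycle_graph k) t) B} ->
  ~~ rainbow (cycle_graph (k - 2)) A ->
  exists (D : {set {set {set V}}}) (h : V -> 'I_k), [/\ D \subset A,
    Q * (#|D| * #|A| + (k * t) ^ 2 * #|A| ^ 2) <= Q * #|V| ^ 2 * #|A| + #|V| ^ 4
  & forall x y, [set x; y] \in cover A :\: cover D -> cycle_rel (h x) (h y)].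
Proof.
move=> k4 k_odd t0; pose s := (k - 5)./2.
have kE : k = s.*2 + 5 by rewrite /s; lia.
have [N HN] := copies_stability s Q t0; exists N => V A nV tA copyA nr.
have k0 : 0 < k by lia.
(* The averaging needs at least one copy, so the empty family is treated apart. *)
have [A0|/set0Pn[B0 B0A]] := eqVneq A set0.
  exists set0, (fun _ => Ordinal k0); rewrite sub0set A0 /cover big_set0; split=> //.
    by rewrite !cards0 !muln0.
  by move=> x y; rewrite !inE.
pose I := {B : {set {set V}} | B \in A}.
have exI (a : I) : exists f : {ffun tblowup (cycle_graph k) t -> V},
    injectiveb f && (val a == [set f @: E | E : {set _} in edges (tblowup (cycle_graph k) t)]).
  exact/existsP/(copyA _ (valP a)).
pose phi (a : I) : tblowup (cycle_graph k) t -> V := xchoose (exI a).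
have phi_inj a : injective (phi a).
  by have /andP[/injectiveP] := xchooseP (exI a).
have in_copyE a x y : in_copy phi a x y = ([set x; y] \in val a).
  have /andP[_ /eqP->] := xchooseP (exI a).
  by apply/in_copyP/(copy_edgeP _ _ (phi_inj a)).
have uniq a b x y : in_copy phi a x y -> in_copy phi b x y -> a = b.
  rewrite !in_copyE => xa xb; apply: val_inj; apply/eqP/negPn/negP => ab.
  have /trivIsetP/(_ _ _ (valP a) (valP b) ab) := tA.
  by move/disjoint_setI0/setP/(_ [set x; y]); rewrite !inE xa xb.
have I0 : 0 < #|{: I}| by apply/card_gt0P; exists (Sub B0 B0A).
have nrphi : no_rainbow_cycle phi s.*2.+3.
  move=> g g_inj ge; move: nr; rewrite (_ : k - 2 = s.*2.+3) => [nr|]; last by lia.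
  pose B := [set g @: E | E : {set _} in edges (cycle_graph s.*2.+3)].
  have B_edge E : E \in B -> exists i, E = [set g i; g (ordS i)].
    case/imsetP => _ /edgesP[i [j [/andP[_ ij] ->]]] ->; rewrite imset_pair.
    by case/orP: ij => /eqP->; [exists i | exists j; rewrite setUC].
  have B_cover : B \subset cover A.
    apply/subsetP => _ /B_edge[i ->]; have /existsP[a] := ge i.
    by rewrite in_copyE => gi; apply/bigcupP; exists (val a); first exact: valP.
  have B_copy : is_copy (cycle_graph s.*2.+3) B.
    apply/existsP; exists [ffun i => g i]; apply/andP; split.
      by apply/injectiveP => i j; rewrite !ffunE => /g_inj.
    by apply/eqP/eq_imset => E; apply: eq_imset => i; rewrite ffunE.
  move: nr; rewrite negb_exists => /forallP/(_ B); rewrite B_copy B_cover /=.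
  case/dinjectivePn => E EB [E' /andP[E'E E'B] EE'].
  have EP := subsetP B_cover _ EB; have E'P := subsetP B_cover _ E'B.
  have [i Ei] := B_edge _ EB; have [j E'j] := B_edge _ E'B.
  exists i, j, (Sub (pblock A E) (pblock_mem EP)); split.
  - by apply: contraNneq E'E => ij; rewrite Ei E'j ij.
  - by rewrite in_copyE -Ei mem_pblock.
  - by rewrite in_copyE -E'j /= EE' mem_pblock.
have cI : #|{: I}| = #|A| by rewrite card_sig.
move: HN phi phi_inj in_copyE uniq nrphi; rewrite -kE.
move=> HN phi phi_inj in_copyE uniq nrphi.
have [D [h [le hP]]] := HN _ _ phi nV phi_inj uniq nrphi I0.
exists (val @: D), h; split.
- by apply/subsetP => _ /imsetP[a _ ->]; apply: valP.
- by rewrite card_imset -?cI //; apply: val_inj.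
- move=> x y; rewrite inE => /andP[xyD /bigcupP[B BA xyB]].
  apply: (hP (Sub B BA)); last by rewrite in_copyE.
  apply: contra xyD => BD; apply/bigcupP; exists B => //.
  by apply/imsetP; exists (Sub B BA).
Qed.

(** * Lower bound *)

(** Fewer than k vertices miss some class, and C_k without that class is a path, which is
    bipartite. *)
Lemma no_odd_cycle_hom m k (h : 'I_m -> 'I_k) : 2 < k -> odd m -> m < k ->
  ~ forall i, cycle_rel (h i) (h (ordS i)).
Proof.
move=> k2 m_odd mk hP.
have [c hc] : exists c, forall i, h i != c.
  have /subsetPn[c _ hc] : ~~ ([set: 'I_k] \subset codom h).
    apply/negP => /subset_leq_card; rewrite cardsT card_ord => /leq_trans/(_ (card_size _)).
    by rewrite size_codom card_ord leqNgt mk.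
  by exists c => i; apply: contra hc => /eqP<-; apply: codom_f.
(* The cycle minus the class c is a path, along which r is the coordinate. *)
pose r i := if c < h i then h i - c else h i + k - c.
have r_flip i : odd (r (ordS i)) = ~~ odd (r i).
  move: (hc i) (hc (ordS i)) (hP i); rewrite cycle_relE // -!val_eqE /= /r.
  move: (ltn_ord (h i)) (ltn_ord (h (ordS i))) (ltn_ord c).
  by case: ifP; case: ifP; lia.
have m0 : 0 < m by lia.
have rE j (jm : j < m) : odd (r (Ordinal jm)) = odd j (+) odd (r (Ordinal m0)).
  elim: j jm => [|j IH] jm /=; first by congr (odd (r _)); apply: val_inj.
  rewrite addNb -(IH (ltnW jm)) -r_flip; congr (odd (r _)); apply: val_inj => /=.
  by rewrite modn_small.
have m1 : m.-1 < m by lia.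
have := r_flip (Ordinal m1); rewrite rE (_ : ordS _ = Ordinal m0); last first.
  by apply: val_inj => /=; rewrite prednK // modnn.
by rewrite (_ : odd m.-1 = false); [case: odd | lia].
Qed.

Section Construction.
Variables (k t q n : nat).
Hypotheses (k_gt4 : 4 < k) (k_odd : odd k) (t_gt0 : 0 < t) (size_le : k * q.+1 * t <= n).
Notation F := (tblowup (cycle_graph k) t).

Definition offset (w : 'I_q.+1 * 'I_q.+1) (c : 'I_k) : 'I_q.+1 :=
  if odd c then w.2 else if c.+1 == k then inord ((w.1 + w.2) %% q.+1) else w.1.

(** Consecutive offsets form one of the pairs (x, y), (y, x), (y, x + y), (x + y, x), and each of
    these determines x and y. *)
Lemma offset_inj w w' c c' : cycle_rel c c' ->
  offset w c = offset w' c -> offset w c' = offset w' c' -> w = w'.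
Proof.
wlog : c c' / (c' == c.+1 :> nat) || (c == 0 :> nat) && (c'.+1 == k).
  have k2 : 2 < k by lia.
  move=> H cc'; have [|] := boolP ((c' == c.+1 :> nat) || (c == 0 :> nat) && (c'.+1 == k)).
    by move/H; apply.
  move: (cc'); rewrite cycle_relE // => cc'E ncc' Ec Ec'.
  by apply: (H c' c) => //; [move: cc'E ncc'; lia | rewrite cycle_rel_sym].
have last_inj (x y z : 'I_q.+1) :
    (inord ((x + y) %% q.+1) = inord ((x + z) %% q.+1) :> 'I_q.+1) -> y = z.
  move/(congr1 val); rewrite /= !inordK ?ltn_pmod // => /eqP; rewrite eqn_modDl.
  by rewrite !modn_small // => /eqP/val_inj.
case: w w' => x y [x' y'] H _; rewrite /offset /=; have := ltn_ord c; have := ltn_ord c'.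
have [/eqP c'E|/andP[/eqP c0 /eqP c'k]] := orP H; last first.
  rewrite c0 c'k eqxx /= (_ : odd c' = false); last by lia.
  by rewrite (_ : 1 == k = false); [move=> _ _ -> /last_inj-> | lia].
rewrite c'E /=; case: (odd c) => /= _ _; last first.
  rewrite (_ : c.+1 == k = false); first by move=> -> ->.
  by have := ltn_ord c'; lia.
by case: ifP => _ ->; [rewrite addnC [x' + _]addnC => /last_inj-> | move=> ->].
Qed.

Lemma exists_embedding : exists f : 'I_k * 'I_q.+1 * 'I_t -> 'I_n, injective f.
Proof.
have le : #|{: 'I_k * 'I_q.+1 * 'I_t}| <= n by rewrite !card_prod !card_ord.
by exists (fun z => widen_ord le (enum_rank z)) => z z' /(congr1 val) /=
  /val_inj/enum_rank_inj.
Qed.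

Lemma ex_multicolor_ge : q.+1 ^ 2 <= ex_multicolor F n (cycle_graph (k - 2)).
Proof.
have [emb emb_inj] := exists_embedding; have k2 : 2 < k by lia.
pose phi w (p : F) := emb (tag p, offset w (tag p), tagged p).
pose B w := [set phi w @: E | E : {set F} in edges F].
have phiE w w' p p' : phi w p = phi w' p' -> tag p = tag p' /\ offset w (tag p) = offset w'
  (tag p).
  by move/emb_inj => [-> -> _].
have phi_inj w : injective (phi w).
  by move=> [c i] [c' i'] /emb_inj /= [cc _]; rewrite cc in i' * => ->.
have B_disj E w w' : E \in B w -> E \in B w' -> w = w'.
  case/imsetP => _ /edgesP[p [r [pr ->]]] ->; rewrite imset_pair => /(copy_edgeP _ _
    (phi_inj w')).
  case=> p' [r' [_ /esym/phiE[_ Ep] /esym/phiE[_ Er]]].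
  exact: offset_inj pr Ep Er.
(* Disjointness separates only nonempty edge sets, so this is what makes [B] injective. *)
have B_nonempty w : exists E, E \in B w.
  have k0 : 0 < k by lia.
  pose c := Ordinal k0.
  pose p := class_point t_gt0 c.
  pose r := class_point t_gt0 (ordS c).
  exists [set phi w p; phi w r]; apply/(copy_edgeP _ _ (phi_inj w)); exists p, r; split=> //.
  by rewrite /= /blowup_rel /= cycle_relE //= modn_small; lia.
have B_inj : injective B.
  by move=> w w' ww'; have [E Ew] := B_nonempty w; apply: (B_disj E) => //; rewrite -ww'.
have -> : q.+1 ^ 2 = #|[set B w | w : 'I_q.+1 * 'I_q.+1]|.
  by rewrite card_imset // card_prod card_ord mulnn.
apply: (@leq_bigmax_cond _ _ (fun A : {set {set {set 'I_n}}} => #|A|)).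
apply/and3P; split.
- apply/trivIsetP => _ _ /imsetP[w _ ->] /imsetP[w' _ ->] ne.
  rewrite -setI_eq0; apply/eqP/setP => E; rewrite !inE; apply/negP => /andP[Ew Ew'].
  by rewrite (B_disj _ _ _ Ew Ew') eqxx in ne.
- apply/forall_inP => _ /imsetP[w _ ->]; apply/existsP; exists [ffun p => phi w p].
  apply/andP; split; first by apply/injectiveP => p p'; rewrite !ffunE => /phi_inj.
  by apply/eqP/eq_imset => E; apply: eq_imset => p; rewrite ffunE.
(* Any C_{k-2} in the union, rainbow or not, would be mapped by [cls] homomorphically to C_k. *)
apply/existsP => -[B' /and3P[/existsP[g /andP[_ /eqP->]] sub _]].
have k0 : 0 < k by lia.
pose cls v : 'I_k := if [pick z | emb z == v] is Some z then z.1.1 else Ordinal k0.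
have clsE w p : cls (phi w p) = tag p.
  by rewrite /cls; case: pickP => [z /eqP/emb_inj->|/(_ (tag p, offset w (tag p), tagged
    p))] //; rewrite eqxx.
apply: (@no_odd_cycle_hom (k - 2) k (cls \o g)); [lia|lia|lia|] => i.
have : [set g i; g (ordS i)] \in cover [set B w | w : 'I_q.+1 * 'I_q.+1].
  apply: (subsetP sub); apply/imsetP; exists [set i; ordS i]; last by rewrite imset_pair.
  apply/edgesP; exists i, (ordS i); split=> //=;
    rewrite /cycle_rel /= eqxx andbT eq_sym ordS_neq //; lia.
case/bigcupP => _ /imsetP[w _ ->] /(copy_edgeP _ _ (phi_inj w))[p [r [pr pi ri]]].
by rewrite /= -pi -ri !clsE.
Qed.
End Construction.

(** * Asymptotics *)

From mathcomp Require Import boolp classical_sets functions reals topology.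
From mathcomp Require Import normedtype landau.
Import Order.TTheory GRing.Theory Num.Theory numFieldNormedType.Exports.

Lemma exists_nat_ge (R : realType) (x : R) : exists N : nat, (x <= N%:R)%R.
Proof. by exists (Num.truncn x).+1; apply/ltW/truncnS_gt. Qed.

(** With x = n^2, a violation gives m > eps x and K m - x > eps K x. Their product exceeds eps^2 K
    x^2, which is at least x^2/Q. *)
Lemma family_size_le (R : realType) (K Q m n : nat) (eps : R) :
  0 < K -> (0 < eps)%R -> (1 <= eps ^+ 2 * Q%:R)%R ->
  Q * (K * m ^ 2) <= Q * n ^ 2 * m + n ^ 4 ->
  (m%:R <= n%:R ^+ 2 / K%:R + eps * n%:R ^+ 2)%R.
Proof.
move=> K0 eps0 Qeps; rewrite -(ler_nat R) natrD !(natrX, natrM).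
have K1 : (1 <= K%:R :> R)%R by rewrite ler1n.
have Km : (K%:R * (n%:R ^+ 2 / K%:R) = n%:R ^+ 2 :> R)%R.
  by rewrite mulrC divfK // lt0r_neq0 // (lt_le_trans ltr01).
move: (_ / _)%R Km => z; set x := (n%:R ^+ 2)%R => Km.
have -> : (n%:R ^+ 4 = x ^+ 2 :> R)%R by rewrite /x -exprM.
have x0 : (0 <= x)%R by apply: exprn_ge0.
move: (m%:R)%R (Q%:R)%R (K%:R)%R K1 Km Qeps => {K0} M q L L1 Lz qeps H.
have ex0 : (0 <= eps * x)%R by rewrite mulr_ge0 // ltW.
have L0 : (0 < L)%R := lt_le_trans ltr01 L1.
have q0 : (0 < q)%R.
  by rewrite -(pmulr_rgt0 _ (exprn_gt0 2 eps0)); apply: lt_le_trans qeps.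
rewrite leNgt; apply/negP => lt.
have z0 : (0 <= z)%R by rewrite -(pmulr_rge0 _ L0) Lz.
have lt1 : (eps * x < M)%R by lra.
have lt2 : (L * (eps * x) < L * M - x)%R.
  have -> : (L * M - x = L * (M - z))%R by rewrite mulrBr Lz.
  by rewrite ltr_pM2l //; lra.
have := ltr_pM ex0 (mulr_ge0 (ltW L0) ex0) lt1 lt2.
rewrite -(ltr_pM2l q0) => lt3.
have : (x ^+ 2 <= q * (eps * x * (L * (eps * x))))%R.
  have -> : (q * (eps * x * (L * (eps * x))) = (eps ^+ 2 * q) * L * x ^+ 2)%R by ring.
  by rewrite ler_peMl ?exprn_ge0 // -[1%R]mulr1 ler_pM.
nra.
Qed.

Lemma ex_multicolor_asymp (R : realType) k t (eps : R) :
  4 < k -> odd k -> 0 < t -> (0 < eps)%R -> exists N, forall n, N < n ->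
  (`|(ex_multicolor (tblowup (cycle_graph k) t) n (cycle_graph (k - 2)))%:R
      - n%:R ^+ 2 / (k * t)%:R ^+ 2| <= eps * n%:R ^+ 2 :> R)%R.
Proof.
move=> k4 k_odd t0 eps0; have kt0 : 0 < k * t by rewrite muln_gt0 t0; lia.
have [Q HQ] := exists_nat_ge ((eps ^+ 2)^-1)%R.
have [N1 HN1] := family_stability Q k4 k_odd t0.
have [N2 HN2] := exists_nat_ge (2 / eps)%R.
exists (N1 + N2 + k * t) => n nN.
rewrite ler_distl; apply/andP; split; last first.
  rewrite /ex_multicolor; elim/big_ind: _ => [|a b|A /and3P[tA /forall_inP cA rA]].
  - by rewrite addr_ge0 ?mulr_ge0 ?invr_ge0 ?exprn_ge0 ?(ltW eps0).
  - by rewrite /maxn; case: ifP.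
  rewrite -(natrX _ (k * t)); apply: (@family_size_le _ _ Q) => //;
    first by rewrite expn_gt0 kt0.
    by rewrite mulrC -ler_pdivrMr ?exprn_gt0 // div1r.
  have nV : N1 < #|{: 'I_n}| by rewrite card_ord; lia.
  have [D [h [_ + _]]] := HN1 _ A nV tA cA rA.
  rewrite card_ord; apply: leq_trans; rewrite leq_mul2l leq_addl orbT //.
pose q := n %/ (k * t).
have qn : q * (k * t) <= n := leq_trunc_div _ _.
have nq := ltn_ceil n kt0; rewrite -/q in nq.
(* The construction has [q.+1] offsets, hence the predecessor of [q] below. *)
have q0 : 0 < q by rewrite divn_gt0 //; lia.
have qq : k * q.-1.+1 * t <= n by rewrite prednK //; lia.
have := ex_multicolor_ge k4 k_odd t0 qq; rewrite prednK // -(ler_nat R).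
apply: le_trans; rewrite natrX.
move: nq; rewrite -(ltr_nat R) natrM -natr1.
have L0 : (0 < (k * t)%:R :> R)%R by rewrite ltr0n.
have L1 : (1 <= (k * t)%:R :> R)%R by rewrite ler1n.
(* Rounding z = n/(kt) down loses at most 2z, hence at most 2n, in the square; this is within eps
   n^2 once eps n is at least 2. *)
have n2 : (2 <= eps * n%:R :> R)%R.
  rewrite mulrC -ler_pdivrMr //; apply: le_trans HN2 _; rewrite ler_nat; lia.
rewrite -expr_div_n -ltr_pdivrMr // => nq.
have : (n%:R / (k * t)%:R <= n%:R :> R)%R by rewrite ler_pdivrMr // ler_peMr.
have : (0 <= n%:R / (k * t)%:R :> R)%R by rewrite divr_ge0.
have x0 := ler0n R n; have y0 := ler0n R q.
move: nq n2 x0 y0; set z := (n%:R / _)%R; set x := (n%:R)%R; set y := (q%:R)%R.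
move=> nq n2 x0 y0 z0 zx.
have H : (2 * x <= eps * x ^+ 2)%R by rewrite expr2 mulrA ler_wpM2r.
have [z1|z1] := lerP z 1; first by nra.
have : ((z - 1) ^+ 2 <= y ^+ 2)%R by rewrite ler_sqr ?nnegrE ?subr_ge0 // ?ltW // ltrBlDr.
rewrite sqrrB1; lra.
Qed.

(** With x = n^2, K m is at least x - (3/2) eps K x, so c > 2 eps K x gives c + K m - x > eps K x/2.
    Multiplied by m > 2 eps K x this exceeds eps^2 K^2 x^2, hence x^2/Q. *)
Lemma deleted_size_le (R : realType) (K Q m n c : nat) (eps : R) :
  0 < K -> (0 < eps)%R -> (1 <= eps ^+ 2 * Q%:R)%R ->
  Q * (c * m + K * m ^ 2) <= Q * n ^ 2 * m + n ^ 4 ->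
  (n%:R ^+ 2 / K%:R - eps / 2 * n%:R ^+ 2 - eps * n%:R ^+ 2 <= m%:R)%R ->
  (2 * eps * (K%:R * n%:R ^+ 2) < m%:R)%R ->
  (c%:R <= 2 * eps * (K%:R * n%:R ^+ 2))%R.
Proof.
move=> K0 eps0 Qeps; rewrite -(ler_nat R) natrM !natrD !(natrX, natrM).
have K1 : (1 <= K%:R :> R)%R by rewrite ler1n.
have Km : (K%:R * (n%:R ^+ 2 / K%:R) = n%:R ^+ 2 :> R)%R.
  by rewrite mulrC divfK // lt0r_neq0 // (lt_le_trans ltr01).
move: (_ / K%:R)%R Km => z; set x := (n%:R ^+ 2)%R => Km.
have -> : (n%:R ^+ 4 = x ^+ 2 :> R)%R by rewrite /x -exprM.
have x0 : (0 <= x)%R by apply: exprn_ge0.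
move: (m%:R)%R (c%:R)%R (Q%:R)%R (K%:R)%R K1 Km Qeps => {K0} M C q L L1 Lz qeps H ge gt.
have L0 : (0 < L)%R := lt_le_trans ltr01 L1.
have a0 : (0 <= eps * (L * x))%R by rewrite mulr_ge0 ?(ltW eps0) // mulr_ge0 // ltW.
have q0 : (0 < q)%R.
  by rewrite -(pmulr_rgt0 _ (exprn_gt0 2 eps0)); apply: lt_le_trans qeps.
rewrite leNgt; apply/negP => lt.
have lt1 : (2 * (eps * (L * x)) < M)%R by lra.
have lt2 : (eps * (L * x) / 2 < C + (L * M - x))%R.
  have := ler_wpM2l (ltW L0) ge; rewrite !mulrBr Lz; lra.
have b0 : (0 <= eps * (L * x) / 2)%R by lra.
have c0 : (0 <= 2 * (eps * (L * x)))%R by lra.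
have := ltr_pM c0 b0 lt1 lt2.
rewrite -(ltr_pM2l q0) => lt3.
have : (x ^+ 2 <= q * (2 * (eps * (L * x)) * (eps * (L * x) / 2)))%R.
  have -> : (q * (2 * (eps * (L * x)) * (eps * (L * x) / 2)) = (eps ^+ 2 * q) * L ^+ 2 * x
    ^+ 2)%R by field.
  by rewrite ler_peMl ?exprn_ge0 // -[1%R]mulr1 ler_pM // expr_ge1 // ltW.
nra.
Qed.

(** Every class receives all of [H], so [v] is placed in class [h v] under its own name. *)
Lemma subgraph_blowup k (H : sgraph) (D : {set {set {set H}}}) (h : H -> 'I_k) :
  (forall x y, [set x; y]%SET \in (edges H :\: finset.cover D)%SET -> cycle_rel (h x) (h y)) ->
  exists X : cycle_graph k -> finType, is_subgraph (delete_copies D) (blowup X).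
Proof.
move=> hP; exists (fun=> H : finType).
exists (fun v : H => Tagged (fun=> H : finType) v (i := h v) : blowup (fun _ : cycle_graph
  k => H : finType)).
split=> [x y|x y /andP[_ xy]]; last exact: hP.
by move=> E; have := congr1 (fun w : {_ : cycle_graph k & H} => tagged w) E.
Qed.

Local Open Scope ring_scope.
Local Open Scope classical_set_scope.

Theorem theorem1p5 (R : realType) (k : nat) (hk : (5 <= k)%N) (hodd : odd k) :
  (forall t : nat, (0 < t)%N ->
     (fun n : nat =>
        (ex_multicolor (tblowup (cycle_graph k) t) n (cycle_graph (k - 2)))%:R : R^o)
     = (fun n : nat => n%:R ^+ 2 / (k * t)%:R ^+ 2 : R^o)
       +o_\oo (fun n : nat => n%:R ^+ 2 : R^o))
  /\
  (forall (t : nat) (eps : R), (0 < t)%N -> 0 < eps ->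
     exists N : nat, forall n : nat, (N < n)%N ->
       forall (H : sgraph) (A : {set {set {set H}}}),
         #|H| = n ->
         mono_copies (tblowup (cycle_graph k) t) A ->
         (ex_multicolor (tblowup (cycle_graph k) t) n (cycle_graph (k - 2)))%:R
           - eps * n%:R ^+ 2 <= #|A|%:R ->
         ~~ rainbow (cycle_graph (k - 2)) A ->
         exists D : {set {set {set H}}},
           [/\ D \subset A,
               #|D|%:R <= 2 * eps * (k * t * n)%:R ^+ 2
             & exists X : cycle_graph k -> finType,
                 is_subgraph (delete_copies D) (blowup X)]).
Proof.
split=> [t t0|t eps t0 eps0].
  apply/eqaddoP => eps eps0.
  have [N HN] := ex_multicolor_asymp hk hodd t0 eps0.
  exists N.+1 => // n /= Nn; have := HN n Nn.
  by rewrite [X in eps * X]ger0_norm // exprn_ge0.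
have k0 : (0 < k)%N by lia.
have kt0 : (0 < k * t)%N by rewrite muln_gt0 t0 k0.
have [N1 HN1] := ex_multicolor_asymp hk hodd t0 (divr_gt0 eps0 (ltr0Sn R 1)).
have [Q HQ] := exists_nat_ge ((eps ^+ 2)^-1).
have [N2 HN2] := family_stability Q hk hodd t0.
exists (N1 + N2)%N => n nN H A cH /andP[/and3P[/eqP covA tA _] /forall_inP cA] ge nr.
have -> : (k * t * n)%:R ^+ 2 = ((k * t) ^ 2)%N%:R * n%:R ^+ 2 :> R.
  by rewrite natrM exprMn natrX.
(* If the whole family is within the allowed number, all copies are deleted and no edge remains. *)
have [le|gt] := lerP #|A|%:R (2 * eps * (((k * t) ^ 2)%N%:R * n%:R ^+ 2)).
  exists A; split=> //; apply: (@subgraph_blowup k _ _ (fun=> Ordinal k0)) => x y.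
  by rewrite covA finset.setDv inE.
have nV : (N2 < #|H|)%N by rewrite cH; lia.
have [D [h [DA le hP]]] := HN2 H A nV tA cA nr.
exists D; split=> //; last by apply: (@subgraph_blowup k _ _ h) => x y; rewrite -covA;
  apply: hP.
rewrite cH in le; apply: deleted_size_le le _ gt => //; first by rewrite expn_gt0 kt0.
  by rewrite mulrC -ler_pdivrMr ?exprn_gt0 // div1r.
have n1 : (N1 < n)%N by lia.
have := HN1 n n1; rewrite ler_distl => /andP[exge _].
by apply: le_trans ge; rewrite lerB // natrX.
Qed.
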